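(* Let $\Gamma=(V,E)$ be a connected graph with $V$ countable and each vertex of finite valence, and let $d$ be the graph metric on $V$. Suppose that for each pair of vertices $a,b\in V$ there is some number $M_{a,b}$ such that, if $c\in V$ is any vertex for which no minimal path from $a$ to $c$ shares a tail with a minimal path from $b$ to $c$, then the perimeter $d(a,b)+d(b,c)+d(c,a)$ of $\{a,b,c\}$ is less than $M_{a,b}$. Then every point of the metric boundary $\partial_d V$ is a Busemann point.
   Context: Graphs are undirected. For a connected graph $\Gamma=(V,E)$, the graph metric $d$ on $V$ is $d(x,y)=$ the minimum length (number of edges) of a path from $x$ to $y$; a minimal path from $x$ to $y$ is a path of length $d(x,y)$. A path from $a$ to $c$ and a path from $b$ to $c$ share a tail if they have a common terminal segment of positive length ending at $c$ (i.e. the same last edge into $c$). Metric compactification: for a complete, locally compact metric space $(X,d)$, let $C_b(X)$ be the commutative unital C*-algebra of bounded continuous functions on $X$ with the uniform norm, and $C_\infty(X)$ the closed subalgebra of functions vanishing at infinity. For $y,z\in X$ let $\varphi_{y,z}(x)=d(x,y)-d(x,z)$, which lies in $C_b(X)$. Let $\mathcal{G}(X,d)$ be the closed (C*-)subalgebra of $C_b(X)$ generated by $C_\infty(X)$, the constant functions and all $\varphi_{y,z}$, $y,z\in X$. The metric compactification $\overline{X}_d$ is the maximal ideal space (Gelfand spectrum) of $\mathcal{G}(X,d)$; it is compact and contains $X$ as an open subset via point evaluations. The metric boundary is $\partial_d X=\overline{X}_d\setminus X$. For a connected graph this is applied to $X=V$ with the graph metric. Let $T$ be an unbounded subset of $\mathbb{R}^+=[0,\infty)$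 containing $0$. A map $\gamma:T\to X$ is an almost-geodesic ray if for every $\varepsilon>0$ there is an integer $N$ such that $|d(\gamma(t),\gamma(s))+d(\gamma(s),\gamma(0))-t|<\varepsilon$ for all $t,s\in T$ with $t\ge s\ge N$. The ray $\gamma$ converges to $\omega\in\partial_d X$ if $\gamma(t)\to\omega$ in $\overline{X}_d$ as $t\to\infty$ in $T$. A point of $\partial_d X$ is a Busemann point if it is the limit of an almost-geodesic ray. *)

(* Defs.v *)
From HB Require Import structures.
From mathcomp Require Import all_boot all_order all_algebra.
From mathcomp Require Import complex.
From mathcomp Require Import all_classical all_reals all_analysis.

Set Implicit Arguments.
Unset Strict Implicit.
Unset Printing Implicit Defensive.

Import Order.TTheory GRing.Theory Num.Theory.
Import numFieldNormedType.Exports.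

Local Open Scope classical_set_scope.
Local Open Scope ring_scope.
Local Open Scope complex_scope.

Section FunctionAlgebras.
Variables (R : realType) (X : metricType R).

(* [^o] selects the structure of [R[i]] as a normed space over itself. *)
Local Notation C := (R[i]^o).

Definition bounded_continuous : set (X -> C) :=
  [set f | bounded_fun f /\ continuous f].

Definition vanishing_at_infinity : set (X -> C) :=
  [set f | continuous f /\
     forall e : R, 0 < e ->
       exists2 K : set X, compact K & forall x, ~ K x -> `|f x| < e%:C].

Definition dist_diff (y z : X) : X -> C :=
  fun x => (mdist x y - mdist x z)%:C.

(* On bounded functions the topology of [{uniform X -> C}] is that of the
   uniform norm. *)
Record closed_cstar_subalgebra (A : set (X -> C)) : Prop :=
  ClosedCstarSubalgebra {
    cstar_bounded_continuous : A `<=` bounded_continuous ;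
    cstarD : forall f g, A f -> A g -> A (f + g) ;
    cstarM : forall f g, A f -> A g -> A (f * g) ;
    cstarZ : forall (a : R[i]) f, A f -> A (a *: f) ;
    cstar_conj : forall f, A f -> A (fun x => (f x)^*) ;
    cstar_closed : closed (A : set {uniform X -> C}) }.

Definition metric_generators : set (X -> C) :=
  vanishing_at_infinity `|` range (fun a : C => cst a : X -> C) `|`
  [set f | exists y z, f = dist_diff y z].

Definition metric_function_set : set (X -> C) :=
  smallest closed_cstar_subalgebra metric_generators.

Definition metric_function_pred : {pred X -> C} :=
  fun f => f \in metric_function_set.

Lemma metric_function_predP f :
  reflect (metric_function_set f) (f \in metric_function_pred).
Proof. exact: asboolP. Qed.

Lemma metric_function_cst (a : C) : metric_function_set (cst a).
Proof. by move=> A [_]; apply; left; right; exists a. Qed.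

Lemma metric_function_subring : subring_closed metric_function_pred.
Proof.
have one : metric_function_set 1 by exact: metric_function_cst.
split; first exact/metric_function_predP.
  move=> f g /metric_function_predP Gf /metric_function_predP Gg.
  apply/metric_function_predP => A [sA GA].
  rewrite -scaleN1r; apply: (cstarD sA); first exact: Gf.
  by apply: (cstarZ sA); exact: Gg.
move=> f g /metric_function_predP Gf /metric_function_predP Gg.
apply/metric_function_predP => A [sA GA].
by apply: (cstarM sA); [exact: Gf|exact: Gg].
Qed.

Lemma metric_function_scaler : GRing.scaler_closed metric_function_pred.
Proof.
move=> a f /metric_function_predP Gf; apply/metric_function_predP => A [sA GA].
by apply: (cstarZ sA); exact: Gf.
Qed.

HB.instance Definition _ := GRing.isSubringClosed.Build (X -> C)
  metric_function_pred metric_function_subring.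
HB.instance Definition _ := GRing.isScaleClosed.Build R[i] (X -> C)
  metric_function_pred metric_function_scaler.

Record metric_algebra := MetricAlgebra {
  metric_fun :> X -> C ;
  metric_funP : metric_fun \in metric_function_pred }.

HB.instance Definition _ := [isSub for metric_fun].
HB.instance Definition _ := [Choice of metric_algebra by <:].
HB.instance Definition _ := GRing.SubChoice_isSubComPzRing.Build _ _ metric_algebra
  metric_function_subring.
HB.instance Definition _ := [SubZmodule_isSubLmodule of metric_algebra by <:].

(* The maximal ideals of a commutative unital C*-algebra are the kernels of its
   characters, that is, of its unital algebra morphisms to the complex numbers;
   these are automatically continuous. *)
Record metric_compactification := Character {
  character :> {rmorphism metric_algebra -> C} ;
  characterZ : scalable character }.

HB.instance Definition _ := gen_eqMixin metric_compactification.
HB.instance Definition _ := gen_choiceMixin metric_compactification.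

(* Gelfand topology: pointwise convergence on the algebra. *)
Definition character_ptws (chi : metric_compactification) :
  {ptws metric_algebra -> C} := chi : metric_algebra -> C.

HB.instance Definition _ := Topological.copy metric_compactification
  (initial_topology character_ptws).

Section PointEvaluation.
Variable x : X.

Definition eval_at (f : metric_algebra) : C := f x.

Lemma eval_at_additive : zmod_morphism eval_at.
Proof. by []. Qed.

Lemma eval_at_multiplicative : monoid_morphism eval_at.
Proof. by []. Qed.

HB.instance Definition _ :=
  GRing.isZmodMorphism.Build metric_algebra C eval_at eval_at_additive.
HB.instance Definition _ :=
  GRing.isMonoidMorphism.Build metric_algebra C eval_at eval_at_multiplicative.

Lemma eval_at_scalable : scalable eval_at.
Proof. by []. Qed.

Definition point_evaluation : metric_compactification :=
  Character eval_at_scalable.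

End PointEvaluation.

Definition metric_boundary : set metric_compactification :=
  ~` range point_evaluation.

End FunctionAlgebras.

Section BusemannPoints.
Variables (R : realType) (X : metricType R).

(* A ray [T -> X] is represented by a function on [R], of which only the values
   on [T] are ever used. *)
Definition almost_geodesic_ray (T : set R) (gamma : R -> X) : Prop :=
  forall e : R, 0 < e -> exists N : int, forall t s : R,
    T t -> T s -> N%:~R <= s -> s <= t ->
    `|mdist (gamma t) (gamma s) + mdist (gamma s) (gamma 0) - t| < e.

Definition busemann_point (omega : metric_compactification X) : Prop :=
  metric_boundary omega /\
  exists (T : set R) (gamma : R -> X),
    [/\ T `<=` `[0, +oo[, ~ has_ubound T, T 0, almost_geodesic_ray T gamma
      & point_evaluation (gamma t) @[t --> within T (pinfty_nbhs R)] --> omega].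

End BusemannPoints.

(* An undirected graph on [V] is a symmetric adjacency relation; loops are
   allowed, and do not affect distances or minimal paths. A path from [x] to
   [y] is given by the sequence of its vertices after [x], so that its length
   is the size of this sequence. *)
Section Graphs.
Variables (V : choiceType) (adj : rel V).

Definition graph_path (x y : V) (p : seq V) : Prop :=
  path adj x p /\ last x p = y.

Definition graph_connected : Prop := forall x y, exists p, graph_path x y p.

Definition share_tail (s t : seq V) : Prop :=
  exists r, [/\ (1 < size r)%N, suffix r s & suffix r t].

Section Distance.
Hypothesis conn : graph_connected.

Definition has_path_of_length (x y : V) (n : nat) : bool :=
  `[< exists2 p, graph_path x y p & size p = n >].

Lemma has_path_ex (x y : V) : exists n, has_path_of_length x y n.
Proof. by have [p pP] := conn x y; exists (size p); apply/asboolP; exists p. Qed.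

Definition graph_dist (x y : V) : nat := ex_minn (has_path_ex x y).

Definition minimal_path (x y : V) (p : seq V) : Prop :=
  graph_path x y p /\ size p = graph_dist x y.

Definition minimal_paths_share_tail (a b c : V) : Prop :=
  exists p q, [/\ minimal_path a c p, minimal_path b c q
                & share_tail (a :: p) (b :: q)].

Lemma graph_dist_path x y : exists p, minimal_path x y p.
Proof.
rewrite /minimal_path /graph_dist.
by case: ex_minnP => n /asboolP[p xyp pn] _; exists p.
Qed.

Lemma graph_dist_le x y p : graph_path x y p -> (graph_dist x y <= size p)%N.
Proof.
rewrite /graph_dist => xyp; case: ex_minnP => n _; apply.
by apply/asboolP; exists p.
Qed.

Lemma graph_distxx x : graph_dist x x = 0%N.
Proof.
by apply/eqP; rewrite -leqn0; apply: (@graph_dist_le x x [::]).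
Qed.

Lemma graph_dist_eq0 x y : graph_dist x y = 0%N -> x = y.
Proof. by have [p [[_ <-] <-]] := graph_dist_path x y; case: p. Qed.

Lemma graph_dist_triangle y x z :
  (graph_dist x z <= graph_dist x y + graph_dist y z)%N.
Proof.
have [p [[xp yp] <-]] := graph_dist_path x y.
have [q [[yq zq] <-]] := graph_dist_path y z.
rewrite -size_cat; apply: graph_dist_le; split.
  by rewrite cat_path xp yp.
by rewrite last_cat yp.
Qed.

Hypothesis adj_sym : symmetric adj.

Lemma graph_dist_sym x y : graph_dist x y = graph_dist y x.
Proof.
suff le u v : (graph_dist u v <= graph_dist v u)%N.
  by apply/eqP; rewrite eqn_leq !le.
have [p [[vp up] <-]] := graph_dist_path v u.
rewrite -(size_belast v) -size_rev; apply: graph_dist_le; split.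
  rewrite -up rev_path (_ : path _ v p = path adj v p) //.
  by apply: eq_path => a b; exact: adj_sym.
by rewrite -up; case: p {vp up} => //= w p; rewrite rev_cons last_rcons.
Qed.

End Distance.
End Graphs.

(* The vertex set as a metric space. The unused arguments let the graph metric
   be inferred from the type. *)
Definition graph_space (R : realType) (V : choiceType) (adj : rel V)
  (conn : graph_connected adj) (adj_sym : symmetric adj) : Type := V.

Arguments graph_space R {V adj} conn adj_sym.

Section GraphSpace.
Variables (R : realType) (V : choiceType) (adj : rel V).
Variables (conn : graph_connected adj) (adj_sym : symmetric adj).

Local Notation space := (graph_space R conn adj_sym).

HB.instance Definition _ := Choice.copy space V.

Let dist (x y : space) : R := (graph_dist conn x y)%:R.

Let distxx x : dist x x = 0.
Proof. by rewrite /dist graph_distxx. Qed.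

Let dist_eq0 x y : dist x y = 0 -> x = y.
Proof. by move/eqP; rewrite pnatr_eq0 => /eqP/graph_dist_eq0. Qed.

Let dist_sym x y : dist x y = dist y x.
Proof. by rewrite /dist (graph_dist_sym conn adj_sym). Qed.

Let dist_triangle y x z : dist x z <= dist x y + dist y z.
Proof. by rewrite /dist -natrD ler_nat graph_dist_triangle. Qed.

HB.instance Definition _ :=
  isMetric.Build R space distxx dist_eq0 dist_sym dist_triangle.

End GraphSpace.

(* Main.v *)
Require Import Defs.
From mathcomp Require Import all_boot all_order all_algebra.
From mathcomp Require Import complex.
From mathcomp Require Import all_classical all_reals all_analysis.
From mathcomp Require Import ring lra zify.

(** Write [d] for the graph metric. A character [omega] of the function algebra
    takes on finitely many functions nearly the values of these functions at
    some vertex ([character_approx]): otherwise the sum of the squares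
    [|f - omega f|^2] would be bounded below, hence invertible in the algebra,
    although [omega] kills it. If [omega] is a boundary point it kills the
    indicator functions of vertices, so that this vertex can be found outside
    any given finite set ([boundary_approx]). The values of
    [d(., y) - d(., z)] are integers, so their approximation is exact, and
    [omega] determines up to a constant an integer-valued function [h] on the
    vertices which on each finite set is, up to a constant, the distance to
    some vertex outside this set ([boundary_horofunction]).

    Say that [m] lies toward [omega] from [a] when [h a - h m = d(a, m)], that
    is, when some geodesic from [a] to [omega] passes through [m]. This is a
    preorder since [h] is 1-Lipschitz, and the perimeter hypothesis makes it
    directed ([toward_directed]). Indeed, let [c] be a far vertex that
    represents [h] on a large finite set. As long as minimal paths from [a] and
    from [b] to [c] share their last edge, [c] can be moved one step back along
    it, staying between [c] and both [a] and [b]; this stops only in a finite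
    ball around [a] that does not depend on [c] ([common_waypoint]). The vertex
    reached is a common bound of [a] and [b], provided that [h] was represented
    on the whole ball. Moreover each vertex has a neighbour one step closer to
    [omega] ([toward_step]).

    As there are countably many vertices, there is a strictly descending
    cofinal chain [a_0, a_1, ...] for this preorder ([toward_chain]). The
    distances along a chain add up, so that it is a geodesic ray; and since
    every vertex [y] eventually satisfies [h y - h (a_n) = d(y, a_n)], the
    differences [d(a_n, y) - d(a_n, z)] are eventually equal to [h y - h z].
    The functions [f] with [f (a_n)] converging to [omega f] form a closed
    self-adjoint algebra, which contains the generators, hence everything
    ([cvg_point_evaluation]). *)

Set Implicit Arguments.
Unset Strict Implicit.
Unset Printing Implicit Defensive.

Import Order.TTheory GRing.Theory Num.Theory.
Import numFieldNormedType.Exports.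

Local Open Scope classical_set_scope.
Local Open Scope ring_scope.

(** * Complex-valued functions and uniform closure *)

Section ComplexValues.
Local Open Scope complex_scope.
Variable R : realType.
Local Notation C := (R[i]^o).

Lemma posc_real (z : R[i]) : 0 < z -> 0 < complex.Re z /\ (complex.Re z)%:C = z.
Proof.
move=> z0; have zE : (complex.Re z)%:C = z by rewrite RRe_real// gtr0_real.
by split=> //; rewrite -ltcR zE.
Qed.

Lemma normc_real (r : R) : `|r%:C : C| = `|r|%:C.
Proof. by rewrite normc_def /= expr0n addr0 sqrtr_sqr. Qed.

Lemma cvgC_distP T (F : set_system T) {FF : Filter F} (f : T -> C) (l : C) :
  f @ F --> l <->
  forall e : R, 0 < e -> \forall t \near F, `|l - f t| < e%:C.
Proof.
split=> [/cvgrPdist_lt fl e e0|fl]; first by apply: fl; rewrite ltcR.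
by apply/cvgrPdist_lt => e /posc_real[e0 <-]; exact: fl.
Qed.

Lemma bounded_funCP T (f : T -> C) :
  bounded_fun f <-> exists M : R, forall x, `|f x| <= M%:C.
Proof.
split=> [[M [Mr fM]]|[M fM]].
  exists (complex.Re (M + 1)) => x; rewrite RRe_real.
    2: by rewrite rpredD// rpred1.
  by apply: fM => //; rewrite ltrDl.
rewrite /= /bounded_near; near=> N => x _ /=; apply: le_trans (fM x) _; near: N.
by apply: nbhs_pinfty_ge; rewrite complex_real.
Unshelve. all: end_near. Qed.

(** Reduces topological closedness to approximation with real errors, the form
    in which all closed algebras below are handled. *)
Lemma uniform_closedP (X : choiceType) (A : set (X -> C)) :
  closed (A : set {uniform X -> C}) <->
  forall f : X -> C,
    (forall e : R, 0 < e ->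
       exists2 g : X -> C, A g & forall x, `|f x - g x| < e%:C) ->
    A f.
Proof.
split=> [clA f fA|clA f clf]; last first.
  apply: clA => e e0.
  have /clf[g [Ag fg]] : nbhs (f : {uniform X -> C})
      [set g : {uniform X -> C} | forall x, `|f x - g x| < e%:C].
    apply/uniform_nbhs; exists [set p : C * C | `|p.1 - p.2| < e%:C].
    split=> [|g fg x]; last exact: fg.
    rewrite -entourage_ballE; exists e%:C => /=; first by rewrite ltcR.
    by move=> [u v] /=; rewrite -ball_normE.
  by exists g.
have clA' : closure (A : set {uniform X -> C}) `<=` A by [].
apply: clA' => B /uniform_nbhs[E [entE EB]].
move: entE; rewrite -entourage_ballE => -[e /= /posc_real[e0 eE] sE].
have [g Ag fg] := fA _ e0; exists g; split=> //; apply: EB => x _.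
by apply: sE => /=; rewrite -ball_normE /= -eE; exact: fg.
Qed.

End ComplexValues.

Lemma cvg_initial (S : choiceType) (T : topologicalType) (f : S -> T)
    (I : Type) (F : set_system I) {FF : Filter F} (u : I -> S) (s : S) :
  f (u i) @[i --> F] --> f s -> u i @[i --> F] --> (s : initial_topology f).
Proof.
move=> fu A; rewrite nbhsE => -[_ [[D oD <-] Ds] sA].
apply: filterS sA _; apply: fu.
exact: open_nbhs_nbhs.
Qed.

(** * The algebra of the metric compactification *)

Section FunctionAlgebra.
Local Open Scope complex_scope.
Variables (R : realType) (X : metricType R).
Local Notation C := (R[i]^o).

(** This shows that some algebra occurs in the intersection defining the
    generated one, so that its members are bounded. *)
Lemma bounded_continuous_cstar :
  closed_cstar_subalgebra (@bounded_continuous R X).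
Proof.
split.
- by move=> f.
- move=> f g [/bounded_funCP[M fM] fc] [/bounded_funCP[N gN] gc]; split.
    apply/bounded_funCP; exists (M + N) => x.
    by rewrite rmorphD (le_trans (ler_normD _ _)) ?lerD.
  by move=> x; apply: cvgD; [exact: fc|exact: gc].
- move=> f g [/bounded_funCP[M fM] fc] [/bounded_funCP[N gN] gc]; split.
    apply/bounded_funCP; exists (M * N) => x.
    by rewrite rmorphM normrM ler_pM.
  by move=> x; apply: (@cvgZ _ C); [exact: fc|exact: gc].
- move=> a f [/bounded_funCP[M fM] fc]; split.
    have /complex_realP[r ar] := normr_real a.
    apply/bounded_funCP; exists (r * M) => x.
    by rewrite rmorphM normrZ [X in X * _]ar ler_wpM2l// -ar.
  by move=> x; apply: cvgZl_tmp; exact: fc.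
- move=> f [/bounded_funCP[M fM] fc]; split.
    by apply/bounded_funCP; exists M => x; rewrite normcJ.
  move=> x; apply/cvgC_distP => e e0.
  have /cvgC_distP/(_ _ e0) := fc x; apply: filterS => t.
  by rewrite -rmorphB /= normcJ.
- apply/uniform_closedP => f fA; split.
    have [g [/bounded_funCP[M gM] _] fg] := fA _ ltr01.
    apply/bounded_funCP; exists (1 + M) => x.
    rewrite rmorphD -[f x](subrK (g x)) (le_trans (ler_normD _ _))// lerD//.
    exact: ltW (fg x).
  move=> x; apply/cvgC_distP => e e0.
  have e30 : 0 < e / 3 by rewrite divr_gt0.
  have [g [_ gc] fg] := fA _ e30.
  have /cvgC_distP/(_ _ e30) := gc x; apply: filterS => t gxt.
  have -> : f x - f t = (f x - g x) + (g x - g t) - (f t - g t).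
    by ring.
  have -> : e = e / 3 + e / 3 + e / 3 by field.
  rewrite 2!rmorphD (le_lt_trans (ler_normB _ _))// ltrD//.
  by rewrite (le_lt_trans (ler_normD _ _))// ltrD.
Qed.

(** The bound [|f| <= |f x| + 1] near each point [x] of the compact set where
    [f] is not small spreads to the whole set by compactness. *)
Lemma vanishing_bounded (f : X -> C) :
  vanishing_at_infinity f -> bounded_fun f.
Proof.
move=> [fc fv]; have [K cK Kf] := fv _ ltr01.
have KM : \forall M \near +oo_R, K `<=` [set x | `|f x| <= M%:C].
  apply: (proj1 (compact_near_coveringP K) cK) => x Kx.
  have /complex_realP[r fxr] := normr_real (f x).
  exists ([set y | `|f x - f y| < 1%:C], [set M | r + 1 <= M]) => /=.
    split; last by apply: nbhs_pinfty_ge; rewrite num_real.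
    by have /cvgC_distP/(_ _ ltr01) := fc x.
  move=> [y M] /= [fxy rM].
  apply: (@le_trans _ _ (r + 1)%:C); last by rewrite lecR.
  rewrite -[f y](subKr (f x)) (le_trans (ler_normB _ _))// rmorphD lerD ?fxr//.
  exact: ltW.
near (pinfty_nbhs R) => M.
have fM : K `<=` [set x | `|f x| <= M%:C] by near: M.
apply/bounded_funCP; exists M => x; have [Kx|nKx] := pselect (K x).
  exact: fM.
rewrite (le_trans (ltW (Kf _ nKx)))// lecR; near: M.
by apply: nbhs_pinfty_ge; rewrite num_real.
Unshelve. all: end_near. Qed.

Lemma dist_diff_bounded (y z x : X) :
  `|dist_diff y z x| <= (mdist y z)%:C.
Proof.
rewrite /dist_diff normc_real lecR ler_norml.
have := metric_triangle x y z; have := metric_triangle x z y.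
by rewrite (metric_sym z y); lra.
Qed.

Lemma dist_diff_continuous (y z : X) : continuous (dist_diff y z).
Proof.
move=> x; apply/cvgC_distP => e e0.
have e20 : 0 < e / 2 by rewrite divr_gt0.
apply: filterS (nbhsx_ballx x _ e20) => t.
rewrite ballEmdist /= /dist_diff -rmorphB normc_real ltcR ltr_norml => xt.
have := metric_triangle x t y; have := metric_triangle t x y.
have := metric_triangle x t z; have := metric_triangle t x z.
by rewrite (metric_sym t x); lra.
Qed.

Lemma metric_generators_bounded_continuous :
  @metric_generators R X `<=` @bounded_continuous R X.
Proof.
move=> f [[|[a _ <-]]|[y [z ->]]].
- by move=> vf; split; [exact: vanishing_bounded|case: vf].
- split; last exact: cst_continuous.
  have /complex_realP[r ar] := normr_real a.
  by apply/bounded_funCP; exists r => x; rewrite -ar.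
- split; last exact: dist_diff_continuous.
  by apply/bounded_funCP; exists (mdist y z) => x; exact: dist_diff_bounded.
Qed.

Lemma metric_function_cstar :
  closed_cstar_subalgebra (@metric_function_set R X).
Proof.
split.
- apply: smallest_sub; first exact: bounded_continuous_cstar.
  exact: metric_generators_bounded_continuous.
- by move=> f g Gf Gg A [sA GA]; apply: (cstarD sA); [exact: Gf|exact: Gg].
- by move=> f g Gf Gg A [sA GA]; apply: (cstarM sA); [exact: Gf|exact: Gg].
- by move=> a f Gf A [sA GA]; apply: (cstarZ sA); exact: Gf.
- by move=> f Gf A [sA GA]; apply: (cstar_conj sA); exact: Gf.
- by apply: closed_bigI => A [sA _]; exact: cstar_closed sA.
Qed.

(** The Neumann series of [1/g] converges uniformly: with [u = 1 - g/M], the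
    partial sums of [M^-1 * (1 + u + u^2 + ...)] differ from [1/g] by
    [u^n / g], and [0 <= u <= 1 - c/M < 1]. *)
Lemma metric_function_inv (g : X -> R) (c M : R) :
  0 < c -> c <= M -> (forall x, c <= g x <= M) ->
  metric_function_set (fun x => (g x)%:C : C) ->
  metric_function_set (fun x => (g x)^-1%:C : C).
Proof.
move=> c0 cM gcM Gg.
have M0 : 0 < M := lt_le_trans c0 cM.
have g0 x : 0 < g x by have /andP[/(lt_le_trans c0)] := gcM x.
pose u x := 1 - g x / M.
(* The partial sums, in Horner form. *)
pose s := fix s n x := if n is n'.+1 then s n' x * u x + M^-1 else 0.
have gs n x : s n x = (g x)^-1 - u x ^+ n / g x.
  elim: n => [|n IHn] /=; first by rewrite expr0 mul1r subrr.
  have := g0 x; rewrite IHn exprS /u => /lt0r_neq0 gx.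
  by field; rewrite gx gt_eqF.
have cstG (a : C) : metric_function_set (cst a : X -> C).
  exact: metric_function_cst.
have cA := metric_function_cstar.
have Gu : metric_function_set (fun x => (u x)%:C : C).
  have -> : (fun x => (u x)%:C : C) =
      (cst 1 : X -> C) + (- M^-1)%:C *: (fun x => (g x)%:C : C).
    apply/funext => x; rewrite /u rmorphB rmorphM /=.
    by rewrite rmorphN /= mulrC -mulNr.
  by apply: (cstarD cA) => //; apply: (cstarZ cA).
have Gs n : metric_function_set (fun x => (s n x)%:C : C).
  elim: n => [|n IHn] /=; first exact: cstG.
  have -> : (fun x => (s n x * u x + M^-1)%:C : C) =
      (fun x => (s n x)%:C : C) * (fun x => (u x)%:C : C) + cst (M^-1)%:C.
    by apply/funext => x; rewrite rmorphD rmorphM.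
  by apply: (cstarD cA) => //; apply: (cstarM cA).
have clG := proj1 (uniform_closedP _) (cstar_closed cA).
apply: clG => e e0.
pose q := 1 - c / M.
have q01 : 0 <= q < 1.
  by rewrite subr_ge0 ltrBlDr ltrDl divr_gt0// ler_pdivrMr// mul1r cM.
have /cvgrPdist_lt/(_ (e * c) (mulr_gt0 e0 c0))[n _ qn] :
    q ^+ n @[n --> \oo] --> 0.
  by apply: cvg_expr; rewrite ger0_norm; case/andP: q01.
exists (fun x => (s n x)%:C) => // x.
rewrite -rmorphB normc_real ltcR gs opprB addrCA subrr addr0.
have /andP[cg gM] := gcM x; have /andP[q0 q1] := q01.
have u0 : 0 <= u x by rewrite subr_ge0 ler_pdivrMr// mul1r.
have uq : u x <= q by rewrite lerD2l lerN2 ler_wpM2r// invr_ge0 ltW.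
rewrite ger0_norm ?divr_ge0 ?exprn_ge0 ?(ltW (g0 x))// ltr_pdivrMr//.
apply: (@le_lt_trans _ _ (q ^+ n)); first exact: lerXn2r.
apply: (@lt_le_trans _ _ (e * c)); last by rewrite ler_pM2l.
by have := qn n (leqnn n); rewrite /= sub0r normrN ger0_norm// exprn_ge0.
Qed.

Lemma metric_generator_function f :
  @metric_generators R X f -> metric_function_set f.
Proof. exact: sub_gen_smallest. Qed.

Definition metric_elt (f : X -> C) (Gf : metric_function_set f) :
  metric_algebra X := MetricAlgebra (introT (metric_function_predP f) Gf).

Lemma metric_algebra_function (f : metric_algebra X) : metric_function_set f.
Proof. exact/metric_function_predP/metric_funP. Qed.

Lemma metric_algebra_inj (f g : metric_algebra X) : f =1 g -> f = g.
Proof. by move=> fg; apply: val_inj; apply/funext. Qed.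

Definition conj_elt (f : metric_algebra X) : metric_algebra X :=
  metric_elt (cstar_conj metric_function_cstar (metric_algebra_function f)).

Definition dist_diff_elt (y z : X) : metric_algebra X :=
  metric_elt (metric_generator_function
    (or_intror (ex_intro _ y (ex_intro _ z erefl)))).

(** Otherwise [g], the sum of the [|f - chi f|^2], would be at least [e^2]
    everywhere, hence invertible in the algebra, while [chi g = 0]. *)
Lemma character_approx (chi : metric_compactification X)
    (fs : seq (metric_algebra X)) (e : R) :
  0 < e -> exists x : X, forall f, f \in fs -> `|f x - chi f| < e%:C.
Proof.
move=> e0; apply: contrapT => /forallNP nx.
pose d f : metric_algebra X :=
  f - (chi f : R[i]) *: (1 : metric_algebra X).
pose g := \sum_(f <- fs) d f * conj_elt (d f).
have dE f x : d f x = f x - chi f.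
  by rewrite -[d f x]/(f x - chi f * 1) mulr1.
have chid f : chi (d f) = 0.
  by rewrite rmorphB /= characterZ rmorph1 [_ *: _]mulr1 subrr.
have chig : chi g = 0.
  by rewrite rmorph_sum big1// => f _; rewrite rmorphM /= chid mul0r.
pose h x := complex.Re (g x).
have gE x : g x = \sum_(f <- fs) `|f x - chi f| ^+ 2.
  rewrite -[g x]/(eval_at x g) rmorph_sum; apply: eq_bigr => f _.
  by rewrite rmorphM -dE sqr_normc.
have hE x : (h x)%:C = g x.
  by rewrite RRe_real// gE ger0_real// sumr_ge0// => f _; exact: exprn_ge0.
have eh x : e ^+ 2 <= h x.
  have /existsNP[f /not_implyP[ffs /negP fx]] := nx x.
  rewrite -lecR hE gE (big_rem f)//= rmorphXn /=.
  apply: (@le_trans _ _ (`|f x - chi f| ^+ 2)).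
    have /complex_realP[r fr] := normr_real (f x - chi f).
    move: fx; rewrite fr ltcR -leNgt => er.
    by rewrite -!rmorphXn lecR lerXn2r ?nnegrE// ?ltW// (lt_le_trans e0).
  by rewrite lerDl sumr_ge0// => k _; exact: exprn_ge0.
have [/bounded_funCP[M gM] _] :=
  cstar_bounded_continuous metric_function_cstar (metric_algebra_function g).
have Gh : metric_function_set (fun x => (h x)%:C : C).
  rewrite (_ : (fun _ => _) = g); first exact: metric_algebra_function.
  exact/funext.
have hM x : e ^+ 2 <= h x <= Num.max (e ^+ 2) M.
  rewrite eh le_max; apply/orP; right; have := gM x.
  by rewrite -hE normc_real lecR; apply: le_trans; exact: ler_norm.
have e20 : 0 < e ^+ 2 by exact: exprn_gt0.
have eM : e ^+ 2 <= Num.max (e ^+ 2) M by rewrite le_max lexx.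
pose k := metric_elt (metric_function_inv e20 eM hM Gh).
have gk : g * k = 1.
  apply: metric_algebra_inj => x; rewrite -[LHS]/(g x * k x) -hE.
  by rewrite -rmorphM divff// gt_eqF// (lt_le_trans e20).
have := rmorph1 chi; rewrite -gk rmorphM /= chig mul0r.
by move=> /esym/eqP; rewrite oner_eq0.
Qed.

Lemma character_norm_le (chi : metric_compactification X)
    (f : metric_algebra X) (B : R) :
  (forall x, `|f x| <= B%:C) -> `|chi f| <= B%:C.
Proof.
move=> fB; have /complex_realP[r fr] := normr_real (chi f).
rewrite fr lecR; apply/ler_addgt0Pr => e e0.
have [x /(_ f (mem_head _ _)) fx] := character_approx chi [:: f] e0.
rewrite -lecR -fr -[chi f](subKr (f x)) (le_trans (ler_normB _ _))//.
by rewrite rmorphD lerD// ltW.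
Qed.

Lemma character_conj (chi : metric_compactification X) (f : metric_algebra X) :
  chi (conj_elt f) = (chi f)^*.
Proof.
apply/eqP; rewrite -subr_eq0 -normr_eq0 eq_le normr_ge0 andbT.
have /complex_realP[r fr] := normr_real (chi (conj_elt f) - (chi f)^*).
rewrite fr lecR; apply/ler_addgt0Pr => e e0; rewrite add0r.
have e20 : 0 < e / 2 by rewrite divr_gt0.
have [x fx] := character_approx chi [:: f; conj_elt f] e20.
have fx1 := fx f (mem_head _ _).
have fx2 : `|(f x)^* - chi (conj_elt f)| < (e / 2)%:C.
  by apply: fx; rewrite inE mem_head orbT.
rewrite -lecR -fr ltW// (splitr e) rmorphD.
have -> : chi (conj_elt f) - (chi f)^* =
    (f x - chi f)^* - ((f x)^* - chi (conj_elt f)).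
  by rewrite rmorphB /=; ring.
by rewrite (le_lt_trans (ler_normB _ _))// ltrD// normcJ.
Qed.

Lemma cvg_compactificationP T (F : set_system T) {FF : Filter F}
    (u : T -> metric_compactification X) (chi : metric_compactification X) :
  (forall f : metric_algebra X, u t f @[t --> F] --> chi f) ->
  u t @[t --> F] --> chi.
Proof.
move=> uchi; apply: (@cvg_initial _ _ (@character_ptws R X)).
apply/cvg_sup => f; apply:
  (@cvg_initial _ _ (fun g : metric_algebra X -> C => g f)).
exact: uchi.
Qed.

(** The functions along which [u] converges to the value of [chi] form a closed
    C*-subalgebra, because characters are contractive and commute with
    conjugation. *)
Lemma cvg_point_evaluation T (F : set_system T) {FF : Filter F}
    (u : T -> X) (chi : metric_compactification X) :
  (forall f : metric_algebra X, @metric_generators R X f ->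
     f (u t) @[t --> F] --> chi f) ->
  point_evaluation (u t) @[t --> F] --> chi.
Proof.
move=> gen; apply: cvg_compactificationP => f /=.
pose A : set (X -> C) := [set g | exists2 h : metric_algebra X,
  h = g :> (X -> C) & h (u t) @[t --> F] --> chi h].
suff /(_ _ (metric_algebra_function f))[h /val_inj <-] :
  @metric_function_set R X `<=` A by [].
have cA := metric_function_cstar.
apply: smallest_sub => [|g Gg]; last first.
  by exists (metric_elt (metric_generator_function Gg)); last exact: gen.
split.
- move=> g [h <- _]; apply: (cstar_bounded_continuous cA).
  exact: metric_algebra_function.
- move=> f1 f2 [g gE ug] [h hE uh]; exists (g + h); first by rewrite -gE -hE.
  by rewrite (rmorphD chi); exact: (cvgD ug uh).
- move=> f1 f2 [g gE ug] [h hE uh]; exists (g * h); first by rewrite -gE -hE.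
  by rewrite (rmorphM chi); exact: (@cvgZ _ C _ _ _ _ _ _ _ ug uh).
- move=> a f1 [g gE ug]; exists (a *: g); first by rewrite -gE.
  by rewrite characterZ; exact: (cvgZl_tmp (k := a) ug).
- move=> f1 [g gE ug]; exists (conj_elt g); first by rewrite -gE.
  rewrite character_conj.
  apply/cvgC_distP => e e0; have /cvgC_distP/(_ _ e0) := ug.
  by apply: filterS => t; rewrite -rmorphB /= normcJ.
- apply/uniform_closedP => g gA.
  have Gg : metric_function_set g.
    have clG := proj1 (uniform_closedP _) (cstar_closed cA).
    apply: clG => e /gA[h [k <- _] gk]; exists k => //.
    exact: metric_algebra_function.
  exists (metric_elt Gg) => //; apply/cvgC_distP => e e0.
  have e30 : 0 < e / 3 by rewrite divr_gt0.
  have [_ [h <- uh] gh] := gA _ e30.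
  have chgh : `|chi (metric_elt Gg - h)| <= (e / 3)%:C.
    by apply: character_norm_le => x; exact/ltW/gh.
  have /cvgC_distP/(_ _ e30) := uh; apply: filterS => t ht.
  have -> : chi (metric_elt Gg) - metric_elt Gg (u t) =
      chi (metric_elt Gg - h) + (chi h - h (u t)) - (g (u t) - h (u t)).
    by rewrite rmorphB /=; ring.
  have -> : e = e / 3 + e / 3 + e / 3 by field.
  rewrite !(rmorphD (real_complex R)) (le_lt_trans (ler_normB _ _))// ltrD//.
  by rewrite (le_lt_trans (ler_normD _ _))// ler_ltD.
Qed.

Lemma eq_character (chi psi : metric_compactification X) :
  chi =1 psi -> chi = psi.
Proof.
case: chi => [[f [[fD] [fM]]] fZ]; case: psi => [[g [[gD] [gM]]] gZ] /= /funext.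
move=> fg; subst g.
by rewrite (Prop_irrelevance gD fD) (Prop_irrelevance gM fM)
  (Prop_irrelevance gZ fZ).
Qed.

End FunctionAlgebra.

(** * Boundary points of a discrete space *)

Section DiscreteBoundary.
Local Open Scope complex_scope.
Variables (R : realType) (X : metricType R).
Local Notation C := (R[i]^o).
Hypothesis discr : forall x : X, open [set x].

(** In an infinite compact set the complements of finite sets would have a
    cluster point, which the complement of that point excludes. *)
Lemma discrete_compact_finite (K : set X) : compact K -> finite_set K.
Proof.
move=> cK; apply: contrapT => infK.
pose F := [set A : set X | finite_set (K `\` A)].
have FF : ProperFilter F.
  split; first by rewrite /F /= setD0.
  split; rewrite /F /=; first by rewrite setDT.
    by move=> A B fA fB; rewrite /F /= setDIr finite_setU.
  by move=> A B AB; apply: sub_finite_set; exact: setDS.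
have [|x [Kx clx]] := cK F FF; first by rewrite /F /= setDv.
have FKx : F (~` [set x]).
  rewrite /F /= setDE setCK; apply: sub_finite_set (finite_set1 x).
  exact: subIsetr.
have nx : nbhs x [set x] by apply: open_nbhs_nbhs; split.
by have [y [nyx /nyx]] := clx _ _ FKx nx.
Qed.

Lemma discrete_continuous (f : X -> C) : continuous f.
Proof.
move=> x A /nbhs_singleton fxA.
have : nbhs x [set x] by apply: open_nbhs_nbhs; split.
by apply: filterS => y ->.
Qed.

Lemma indicator_vanishing (x : X) :
  vanishing_at_infinity (fun y => (y == x)%:R : C).
Proof.
split=> [|e e0]; first exact: discrete_continuous.
exists [set x]; first exact: compact_set1.
by move=> y /eqP/negPf ->; rewrite normr0 ltcR.
Qed.

Definition indicator_elt (x : X) : metric_algebra X :=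
  metric_elt (metric_generator_function
    (or_introl (or_introl (indicator_vanishing x)))).

(** The product of [f] with the indicator [1_x] is [f x] times [1_x], so a
    character that does not kill [1_x] is the evaluation at [x]. *)
Lemma boundary_indicator (omega : metric_compactification X) (x : X) :
  metric_boundary omega -> omega (indicator_elt x) = 0.
Proof.
move=> bo; apply: contrapT => /eqP nz; apply: bo; exists x => //.
have ev (f : metric_algebra X) : eval_at x f = omega f.
  apply: (mulIf nz); rewrite -rmorphM.
  have -> : f * indicator_elt x = (f x : R[i]) *: indicator_elt x.
    apply: metric_algebra_inj => y.
    rewrite -[LHS]/(f y * (y == x)%:R) -[RHS]/(f x * (y == x)%:R).
    by case: eqP => [->//|_]; rewrite !mulr0.
  by rewrite characterZ.
by apply: eq_character => f; exact: ev.
Qed.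

(** Approximating also the indicators of the points of [s], which [omega]
    kills, to within 1 keeps [x] off [s]. *)
Lemma boundary_approx (omega : metric_compactification X)
    (fs : seq (metric_algebra X)) (s : seq X) (e : R) :
  metric_boundary omega -> 0 < e ->
  exists2 x, x \notin s & forall f, f \in fs -> `|f x - omega f| < e%:C.
Proof.
move=> bo e0.
have e'0 : 0 < Num.min e 1 by rewrite lt_min e0 ltr01.
have [x fx] := character_approx omega (fs ++ map indicator_elt s) e'0.
exists x => [|f ffs].
  apply/negP => xs; have : `|indicator_elt x x - omega (indicator_elt x)| <
      (Num.min e 1)%:C by apply: fx; rewrite mem_cat map_f ?orbT.
  rewrite boundary_indicator// subr0 -[indicator_elt x x]/((x == x)%:R : C).
  by rewrite eqxx normr1 (_ : 1 = 1%:C)// ltcR lt_min ltxx andbF.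
apply: (@lt_le_trans _ _ (Num.min e 1)%:C); first by rewrite fx ?mem_cat ?ffs.
by rewrite lecR ge_min lexx.
Qed.

Lemma boundary_vanishing (omega : metric_compactification X)
    (f : metric_algebra X) :
  metric_boundary omega -> vanishing_at_infinity f -> omega f = 0.
Proof.
move=> bo [_ fv]; apply/eqP; rewrite -normr_eq0 eq_le normr_ge0 andbT.
have /complex_realP[r fr] := normr_real (omega f).
rewrite fr lecR; apply/ler_addgt0Pr => e e0; rewrite add0r.
have e20 : 0 < e / 2 by rewrite divr_gt0.
have [K /discrete_compact_finite/finite_seqP[s ->] Kf] := fv _ e20.
have [x xs /(_ f (mem_head _ _)) fx] := boundary_approx [:: f] s bo e20.
rewrite -lecR -fr -[omega f](subKr (f x)) ltW// (splitr e) rmorphD.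
rewrite (le_lt_trans (ler_normB _ _))// ltrD//.
by apply: Kf; exact/negP.
Qed.

End DiscreteBoundary.

(** * Vertices on the way to a point at infinity *)

Section GraphHorizon.
Variables (V : choiceType) (adj : rel V).
Hypotheses (conn : graph_connected adj) (adj_sym : symmetric adj).
Local Notation d := (graph_dist conn).

Let d_sym x y : d x y = d y x := graph_dist_sym conn adj_sym x y.

Let d_tri y x z : (d x z <= d x y + d y z)%N := graph_dist_triangle conn y x z.

Lemma graph_dist_adj x y : adj x y -> (d x y <= 1)%N.
Proof.
move=> xy; apply: (@graph_dist_le _ _ conn x y [:: y]).
by split; rewrite //= xy.
Qed.

Lemma graph_dist_next x y : x != y ->
  exists2 z, adj x z & d x y = (d z y).+1.
Proof.
have [p [[]]] := graph_dist_path conn x y.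
case: p => [_ /= -> _ /eqP//|z p /= /andP[xz zp] py psz _].
exists z => //; apply/eqP; rewrite eqn_leq; apply/andP; split.
  by rewrite (leq_trans (d_tri z x y))// -add1n leq_add2r graph_dist_adj.
by rewrite -psz ltnS; apply: graph_dist_le.
Qed.

Lemma last_step_dist a c p c' c'' : minimal_path conn a c p ->
  suffix [:: c'; c''] (a :: p) ->
  adj c' c /\ d a c = (d a c').+1.
Proof.
move=> [[ap pc] psz] /suffixP[s]; case: s => [|a' s] [aE pE].
  move: ap pc psz; rewrite aE pE /= => /andP[c'c'' _] c''c.
  by subst; rewrite graph_distxx.
move: ap pc psz; rewrite pE cat_path last_cat /= size_cat /=.
move=> /andP[as_ /andP[sc' /andP[c'c'' _]]] c''c sz; subst c''; split=> //.
apply/eqP; rewrite eqn_leq; apply/andP; split.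
  by rewrite (leq_trans (d_tri c' a c))// -addn1 leq_add2l graph_dist_adj.
rewrite -sz addn2 ltnS -(size_rcons s c'); apply: graph_dist_le.
by split; rewrite ?last_rcons// rcons_path as_.
Qed.

Lemma share_tail_dist a b c : minimal_paths_share_tail conn a b c ->
  exists c', [/\ adj c' c, d a c = (d a c').+1 & d b c = (d b c').+1].
Proof.
move=> [p [q [ap bq [r [r1 rp rq]]]]].
have [c' [c'' cr]] : exists c' c'', suffix [:: c'; c''] r.
  case/lastP: r r1 {rp rq} => // r c''; case/lastP: r => // r c' _.
  by exists c', c''; rewrite -!cats1 -catA suffix_suffix.
have [cc ac] := last_step_dist ap (suffix_trans cr rp).
have [_ bc] := last_step_dist bq (suffix_trans cr rq).
by exists c'.
Qed.

(** While the minimal paths to [c] share a tail, step back to the last vertex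
    [c'] before [c] on it: a waypoint between [a], [b] and [c'] is also one
    between [a], [b] and [c]. The descent ends at a vertex of small
    perimeter. *)
Lemma common_waypoint a b N c :
  (forall c, ~ minimal_paths_share_tail conn a b c ->
     (d a b + d b c + d c a < N)%N) ->
  exists m, [/\ (d a m < N)%N, d a c = (d a m + d m c)%N
              & d b c = (d b m + d m c)%N].
Proof.
move=> perim; have [n] := ubnP (d a c); elim: n c => // n IHn c.
rewrite ltnS => acn.
have [/share_tail_dist[c' [c'c ac bc]]|/perim cN] :=
    pselect (minimal_paths_share_tail conn a b c); last first.
  by exists c; rewrite graph_distxx; split; [rewrite (d_sym a c)|..]; lia.
have [|m [mN ac' bc']] := IHn c'; first by rewrite -ac.
exists m; have := graph_dist_adj c'c; have := d_tri c' m c.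
by have := d_tri m a c; have := d_tri m b c; split=> //; lia.
Qed.

Lemma finite_graph_ball
    (finite_valence : forall x, finite_set [set y | adj x y]) (x : V) n :
  finite_set [set y | (d x y < n)%N].
Proof.
elim: n => [|n IHn]; first by rewrite (_ : mkset _ = set0)// -subset0 => y.
apply: (@sub_finite_set _ _ (x |` \bigcup_(z in [set z | (d x z < n)%N])
  [set y | adj z y])); last first.
  by rewrite finite_setU; split=> //; exact: bigcup_finite.
move=> y /= xyn; have [->|xy] := eqVneq x y; [by left|right].
rewrite eq_sym in xy; have [z yz yx] := graph_dist_next xy.
exists z; rewrite /= 1?adj_sym//.
by move: xyn; rewrite d_sym yx ltnS d_sym.
Qed.

(** Up to a constant, [h] is a limit of distance functions to vertices that
    leave every finite set: since [s] is arbitrary, [c \notin s] both keeps [c]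
    far away and excludes the distance function to a single vertex. *)
Definition horofunction (h : V -> int) : Prop :=
  forall s : seq V, exists2 c, c \notin s &
    {in s &, forall y z, (d y c)%:Z - (d z c)%:Z = h y - h z}.

Section Below.
Variable h : V -> int.
Hypothesis horo : horofunction h.

(** Equality in the Lipschitz bound [h a - h m <= d(a, m)]: some geodesic from
    [a] to the point at infinity described by [h] passes through [m]. *)
Definition toward (a m : V) : Prop := h a - h m = (d a m)%:Z.

Lemma toward_refl a : toward a a.
Proof. by rewrite /toward graph_distxx subrr. Qed.

Lemma horofunction_lipschitz a m : h a - h m <= (d a m)%:Z.
Proof.
have [c _ ch] := horo [:: a; m].
by rewrite -ch ?inE ?eqxx ?orbT//; have := d_tri m a c; lia.
Qed.

Lemma toward_trans b a c : toward a b -> toward b c -> toward a c.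
Proof.
rewrite /toward => ab bc.
by have := horofunction_lipschitz a c; have := d_tri b a c; lia.
Qed.

(** Take the first vertex after [a] on a minimal path to a vertex [c] that
    represents [h] on [a] and its neighbours. *)
Lemma toward_step (finite_valence : forall x, finite_set [set y | adj x y]) a :
  exists2 m, toward a m & h m < h a.
Proof.
have /finite_seqP[s sE] := finite_valence a.
have [c cs ch] := horo (a :: s).
have [m am acm] : exists2 m, adj a m & d a c = (d m c).+1.
  by apply: graph_dist_next; apply: contraNneq cs => ->; rewrite mem_head.
have ms : m \in s by have : [set y | adj a y] m by []; rewrite sE.
have := ch a m (mem_head _ _); rewrite inE ms orbT acm => /(_ isT) ham.
exists m; last lia; rewrite /toward.
by have := horofunction_lipschitz a m; have := graph_dist_adj am; lia.
Qed.

(** A waypoint [m] lies in a ball known in advance, so [c] can be chosen to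
    represent [h] on this ball, and the equalities of [common_waypoint] become
    statements about [h]. *)
Lemma toward_directed (finite_valence : forall x, finite_set [set y | adj x y])
    (perimeter_bound : forall a b, exists N, forall c,
       ~ minimal_paths_share_tail conn a b c ->
       (d a b + d b c + d c a < N)%N) a b :
  exists2 m, toward a m & toward b m.
Proof.
have [N perim] := perimeter_bound a b.
have /finite_seqP[s sE] := finite_graph_ball finite_valence a N.
have [c _ ch] := horo [:: a, b & s].
have [m [mN ac bc]] := common_waypoint c perim.
have ms : m \in [:: a, b & s].
  have : [set y | (d a y < N)%N] m by []; rewrite sE => /= ms.
  by rewrite !inE ms !orbT.
have := ch a m; have := ch b m; rewrite ms !inE !eqxx orbT /toward.
by move=> /(_ isT isT) hb /(_ isT isT) ha; exists m; rewrite -?ha -?hb; lia.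
Qed.

End Below.
End GraphHorizon.

(** Each step goes below the next vertex of an enumeration, which gives
    cofinality, and then one step further, which gives strict descent. *)
Lemma toward_chain (V : countType) (adj : rel V)
    (conn : graph_connected adj) (adj_sym : symmetric adj)
    (finite_valence : forall x, finite_set [set y | adj x y])
    (perimeter_bound : forall a b, exists N, forall c,
       ~ minimal_paths_share_tail conn a b c ->
       (graph_dist conn a b + graph_dist conn b c + graph_dist conn c a < N)%N)
    (h : V -> int) (x0 : V) :
  horofunction conn h ->
  exists a : nat -> V,
    [/\ forall n, toward conn h (a n) (a n.+1),
        forall n, h (a n.+1) < h (a n)
      & forall y, exists n, toward conn h y (a n)].
Proof.
move=> horo.
have next (p : V * V) : exists m, [/\ toward conn h p.1 m,
    toward conn h p.2 m & h m < h p.1].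
  have [m xm ym] :=
    toward_directed adj_sym horo finite_valence perimeter_bound p.1 p.2.
  have [m' mm' hm'] := toward_step horo finite_valence m.
  exists m'; split; [exact: toward_trans mm'|exact: toward_trans mm'|].
  by move: xm; rewrite /toward; lia.
have [f fP] := choice next.
pose v n := odflt x0 (unpickle n).
pose a := fix a n := if n is n'.+1 then f (a n', v n') else x0.
exists a; split=> [n|n|y].
- by have [] := fP (a n, v n).
- by have [] := fP (a n, v n).
- exists (pickle y).+1; have [_ + _] := fP (a (pickle y), v (pickle y)).
  by rewrite /= /v pickleK.
Qed.

(** * The horofunction of a boundary point *)

Section GraphBoundary.
Local Open Scope complex_scope.
Variables (R : realType) (V : countType) (adj : rel V).
Hypotheses (conn : graph_connected adj) (adj_sym : symmetric adj).
Local Notation space := (graph_space R conn adj_sym).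
Local Notation C := (R[i]^o).

Lemma graph_mdist (x y : space) : mdist x y = (graph_dist conn x y)%:R :> R.
Proof. by []. Qed.

Lemma graph_space_discrete (x : space) : open [set x].
Proof.
rewrite openE => y ->; apply/nbhs_ballP; exists 1 => /=; first exact: ltr01.
move=> z; rewrite ballEmdist /= graph_mdist (_ : 1 = 1%:R)// ltr_nat ltnS leqn0.
by move=> /eqP/graph_dist_eq0.
Qed.

(** The functions [d(., y) - d(., z)] take integer values, so approximating
    [omega] on them to within 1/2 already gives its exact value. *)
Lemma boundary_horofunction (omega : metric_compactification space)
    (x0 : space) :
  metric_boundary omega ->
  exists2 h : V -> int, horofunction conn h &
    forall y z, omega (dist_diff_elt (y : space) z) = ((h y - h z)%:~R : R)%:C.
Proof.
move=> bo.
pose f (y : space) := dist_diff_elt y x0.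
pose v (y c : space) : int :=
  (graph_dist conn c y)%:Z - (graph_dist conn c x0)%:Z.
have fE y c : f y c = ((v y c)%:~R : R)%:C.
  rewrite -[f y c]/((mdist c y - mdist c x0)%:C) !graph_mdist /v.
  by congr _%:C; rewrite rmorphB.
have int_inj (k l : int) : `|(k%:~R : R) - l%:~R| < 1 -> k = l.
  by rewrite -rmorphB -intr_norm ltrz1; lia.
have half0 : 0 < 2^-1 :> R by rewrite invr_gt0.
have near_int y (k : int) c :
    `|f y c - (k%:~R : R)%:C| < (2^-1)%:C -> v y c = k.
  rewrite fE -rmorphB normc_real ltcR => vk; apply: int_inj.
  by rewrite (lt_trans vk)// invf_lt1// ltr1n.
have int_value (y : space) : exists k : int, omega (f y) = (k%:~R : R)%:C.
  have [c _] :=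
    boundary_approx graph_space_discrete [:: f y] [::] bo half0.
  move=> /(_ _ (mem_head _ _)) fc; exists (v y c).
  apply/eqP; rewrite -subr_eq0 -normr_eq0 eq_le normr_ge0 andbT.
  have /complex_realP[r fr] := normr_real (omega (f y) - ((v y c)%:~R : R)%:C).
  rewrite fr lecR; apply/ler_addgt0Pr => e e0; rewrite add0r.
  have e'0 : 0 < Num.min e 2^-1 by rewrite lt_min e0 half0.
  have [c' _] :=
    boundary_approx graph_space_discrete [:: f y] [::] bo e'0.
  move=> /(_ _ (mem_head _ _)) fc'.
  (* The integer read off at [c] is the same at all better approximations. *)
  have vv : v y c = v y c'.
    apply: int_inj; rewrite -ltcR -normc_real (rmorphB (real_complex R)).
    move: fc fc'; rewrite !fE => fc fc'.
    have -> : ((v y c)%:~R : R)%:C - ((v y c')%:~R : R)%:C =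
        (((v y c)%:~R : R)%:C - omega (f y)) -
        (((v y c')%:~R : R)%:C - omega (f y)) by ring.
    apply: (@lt_le_trans _ _ (2^-1 + 2^-1)%:C).
      2: by rewrite lecR; lra.
    rewrite (rmorphD (real_complex R)); apply: le_lt_trans (ler_normB _ _) _.
    apply: ltrD; first exact: fc.
    by apply: lt_le_trans fc' _; rewrite lecR ge_min lexx orbT.
  rewrite -lecR -fr vv -fE distrC ltW//.
  by apply: lt_le_trans fc' _; rewrite lecR ge_min lexx.
have [h hP] := choice int_value.
exists h => [s|y z].
  have [c cs fc] :=
    boundary_approx graph_space_discrete (map f s) s bo half0.
  exists c => // y z ys zs.
  have vh u : u \in s -> v u c = h u.
    by move=> us; apply: near_int; rewrite -hP fc// map_f.
  rewrite -vh// -vh// /v (graph_dist_sym conn adj_sym c y).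
  by rewrite (graph_dist_sym conn adj_sym c z); lia.
have -> : dist_diff_elt (y : space) z = f y - f z.
  apply: metric_algebra_inj => x; rewrite -[RHS]/(f y x - f z x) !fE.
  rewrite -rmorphB -rmorphB -[LHS]/((mdist x y - mdist x z)%:C) !graph_mdist /v.
  by congr _%:C; rewrite !rmorphB /= opprB addrA subrK.
by rewrite (rmorphB omega) !hP -!rmorphB.
Qed.

End GraphBoundary.

(** * The geodesic ray along a cofinal chain *)

Section ChainRay.
Local Open Scope complex_scope.
Variables (R : realType) (V : countType) (adj : rel V).
Hypotheses (conn : graph_connected adj) (adj_sym : symmetric adj).
Local Notation space := (graph_space R conn adj_sym).
Local Notation C := (R[i]^o).
Local Notation d := (graph_dist conn).
Variables (h : V -> int) (a : nat -> V).
Hypothesis horo : horofunction conn h.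
Hypothesis a_toward : forall n, toward conn h (a n) (a n.+1).
Hypothesis a_descent : forall n, h (a n.+1) < h (a n).
Hypothesis a_cofinal : forall y, exists n, toward conn h y (a n).

Let r n := d (a 0%N) (a n).

Lemma chain_toward m n : (m <= n)%N -> toward conn h (a m) (a n).
Proof.
move=> /subnK <-; elim: (n - m)%N => [|k IHk]; first exact: toward_refl.
by rewrite addSn; apply: toward_trans IHk (a_toward _).
Qed.

Lemma chain_dist m n : (m <= n)%N -> (r m + d (a m) (a n) = r n)%N.
Proof.
move=> mn; have := chain_toward mn; have := chain_toward (leq0n m).
by have := chain_toward (leq0n n); rewrite /toward /r; lia.
Qed.

Lemma chain_dist_mono m n : (m < n)%N -> (r m < r n)%N.
Proof.
move=> mn; rewrite -(chain_dist (ltnW mn)) -addn1 leq_add2l.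
rewrite lt0n; apply/eqP => /graph_dist_eq0 amn.
have := chain_toward mn; have := a_descent m; rewrite -amn /toward; lia.
Qed.

Lemma chain_dist_ge n : (n <= r n)%N.
Proof. by elim: n => // n /leq_ltn_trans; apply; exact: chain_dist_mono. Qed.

Lemma chain_dist_inj : injective r.
Proof.
move=> m n rmn; apply/eqP; rewrite eqn_leq; apply/andP.
by split; rewrite leqNgt; apply/negP => /chain_dist_mono; rewrite rmn ltnn.
Qed.

Definition chain_times : set R := range (fun n => (r n)%:R : R).

(** Parametrized by the distance from [a 0], as the definition of an
    almost-geodesic ray demands; [xget] recovers the index [n] from it because
    these distances increase strictly. *)
Definition chain_ray (t : R) : space := a (xget 0%N [set n | (r n)%:R = t]).

Lemma chain_rayE n : chain_ray (r n)%:R = a n.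
Proof.
congr a; apply: chain_dist_inj; apply/eqP; rewrite -(eqr_nat R); apply/eqP.
by case: xgetP => [m _ //|/(_ n) []].
Qed.

Lemma chain_times_unbounded : ~ has_ubound chain_times.
Proof.
move=> [M Mub]; pose n := Num.bound `|M|.
have := Mub (r n)%:R (ex_intro2 _ _ n I erefl); apply/negP; rewrite -ltNge.
apply: le_lt_trans (ler_norm M) _.
apply: (lt_le_trans (archi_boundP (normr_ge0 M))).
by rewrite ler_nat chain_dist_ge.
Qed.

Lemma chain_ray_geodesic : almost_geodesic_ray chain_times chain_ray.
Proof.
move=> e e0; exists 0 => _ _ [n _ <-] [m _ <-] _; rewrite ler_nat => rmn.
have mn : (m <= n)%N by rewrite leqNgt; apply/negP => /chain_dist_mono; lia.
have -> : 0 = (r 0)%:R :> R by rewrite /r graph_distxx.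
rewrite !chain_rayE !graph_mdist -natrD.
rewrite (graph_dist_sym conn adj_sym (a n)).
rewrite (graph_dist_sym conn adj_sym (a m) (a 0%N)).
by rewrite -(chain_dist mn) [X in _ - X%:R]addnC subrr normr0.
Qed.

Lemma near_chain_ray (P : V -> Prop) n0 :
  (forall n, (n0 <= n)%N -> P (a n)) ->
  \forall t \near within chain_times (pinfty_nbhs R), P (chain_ray t).
Proof.
move=> Pn; rewrite near_withinE; near=> t => -[n _ rnt].
rewrite -rnt chain_rayE; apply: Pn.
rewrite leqNgt; apply/negP => /chain_dist_mono.
apply/negP; rewrite -leqNgt -(ler_nat R) rnt; near: t.
by apply: nbhs_pinfty_ge; rewrite num_real.
Unshelve. all: end_near. Qed.

(** It suffices to check convergence on the generators: functions vanishing at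
    infinity tend to 0 since the ray leaves every finite set, and distance
    differences are eventually constant along the ray by cofinality. *)
Lemma chain_busemann (omega : metric_compactification space) :
  metric_boundary omega ->
  (forall y z,
     omega (dist_diff_elt (y : space) z) = ((h y - h z)%:~R : R)%:C) ->
  busemann_point omega.
Proof.
move=> bo omegah; split=> //; exists chain_times, chain_ray; split.
- by move=> _ [n _ <-]; rewrite /= in_itv /= andbT ler0n.
- exact: chain_times_unbounded.
- by exists 0%N => //; rewrite /r graph_distxx.
- exact: chain_ray_geodesic.
apply: cvg_point_evaluation => f [[fv|[c _ fc]]|[y [z fyz]]].
- have discr := @graph_space_discrete R V adj conn adj_sym.
  rewrite (boundary_vanishing discr bo fv).
  apply/cvgC_distP => e e0; have [_ /(_ e e0)[K cK Kf]] := fv.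
  have /finite_seqP[s sK] := discrete_compact_finite discr cK.
  apply: (@near_chain_ray (fun x => `|0 - f x| < e%:C)
    (\max_(x <- s) d (a 0%N) x).+1) => n sn.
  rewrite sub0r normrN; apply: Kf; rewrite sK => /= ans.
  have := leq_trans sn (chain_dist_ge n); rewrite ltnNge => /negP; apply.
  by rewrite /r; exact: leq_bigmax_seq.
- have -> : f = (c : R[i]) *: (1 : metric_algebra space).
    apply: metric_algebra_inj => x.
    by rewrite -fc -[RHS]/(c * 1) mulr1.
  rewrite characterZ rmorph1.
  apply/cvgC_distP => e e0; apply: nearW => t.
  by rewrite -[X in _ - X]/(c * 1) subrr normr0 ltcR.
- have -> : f = dist_diff_elt y z.
    by apply: metric_algebra_inj => x; rewrite fyz.
  rewrite omegah; apply/cvgC_distP => e e0.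
  have [n1 yn1] := a_cofinal y; have [n2 zn2] := a_cofinal z.
  apply: (@near_chain_ray
    (fun x => `|((h y - h z)%:~R : R)%:C - dist_diff_elt (y : space) z x|
      < e%:C)
    (maxn n1 n2)) => n; rewrite geq_max => /andP[n1n n2n].
  rewrite (_ : dist_diff_elt (y : space) z (a n) =
      ((h y - h z)%:~R : R)%:C); last first.
    rewrite -[LHS]/((mdist (a n : space) y - mdist (a n : space) z)%:C).
    rewrite !graph_mdist.
    rewrite (graph_dist_sym conn adj_sym _ y) (graph_dist_sym conn adj_sym _ z).
    have := toward_trans horo yn1 (chain_toward n1n).
    have := toward_trans horo zn2 (chain_toward n2n).
    rewrite /toward => hz hy; congr _%:C.
    rewrite (_ : h y - h z = (d y (a n))%:Z - (d z (a n))%:Z); last by lia.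
    by rewrite rmorphB.
  by rewrite subrr normr0 ltcR.
Qed.

End ChainRay.

Theorem theorem2p3 (R : realType) (V : countType) (adj : rel V)
    (adj_sym : symmetric adj) (conn : graph_connected adj)
    (finite_valence : forall x : V, finite_set [set y | adj x y])
    (perimeter_bound : forall a b : V, exists M : R, forall c : V,
       ~ minimal_paths_share_tail conn a b c ->
       (graph_dist conn a b + graph_dist conn b c + graph_dist conn c a)%:R
         < M) :
  forall omega : metric_compactification (graph_space R conn adj_sym),
    metric_boundary omega -> busemann_point omega.
Proof.
move=> omega bo.
(* Approximating no function at all still yields a vertex, the base point. *)
have [x0 _] := character_approx omega [::] (@ltr01 R).
have [h horo omegah] := boundary_horofunction x0 bo.
have perim a b : exists N, forall c, ~ minimal_paths_share_tail conn a b c ->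
    (graph_dist conn a b + graph_dist conn b c + graph_dist conn c a < N)%N.
  have [M cM] := perimeter_bound a b; exists (Num.bound `|M|) => c /cM cabM.
  rewrite -(ltr_nat R) (lt_le_trans cabM)// (le_trans (ler_norm M))// ltW//.
  exact/archi_boundP/normr_ge0.
have [a [a_toward a_descent a_cofinal]] :=
  toward_chain adj_sym finite_valence perim x0 horo.
exact: (chain_busemann horo a_toward a_descent a_cofinal bo omegah).
Qed.
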